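(* Let $h>0$, let $A_h=\frac{1}{h^2}[-1\ \ 2\ \ -1]$ be the three-point discrete Laplacian on the infinite one-dimensional grid $h\mathbb{Z}$, let $M_e$ be the element-wise additive Vanka operator for $A_h$, and let $S_e=I-\omega M_eA_h$, $\omega\in\mathbb{R}$. Let $\widetilde{A}_h(\theta)$ and $\widetilde{M}_e(\theta)$ denote the symbols of $A_h$ and $M_e$, and let $T^{\rm high}=[-\frac{\pi}{2},\frac{3\pi}{2})\setminus[-\frac{\pi}{2},\frac{\pi}{2})$. Then the optimal smoothing factor of $S_e$ is $$\mu_{e,\rm opt}=\min_{\omega\in\mathbb{R}}\ \max_{\theta\in T^{\rm high}}\left|1-\omega\,\widetilde{M}_e(\theta)\widetilde{A}_h(\theta)\right|=\frac{1}{17},$$ and the minimum over $\omega$ is uniquely achieved at $\omega=\frac{12}{17}$.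
   Context: Grid functions are functions $u:h\mathbb{Z}\to\mathbb{C}$. A stencil $[s_{k}]_{k}$ (finitely many nonzero entries, the centre entry being $k=0$) defines the operator $(Su)(x)=\sum_k s_k\,u(x+kh)$. The symbol of such an operator $S$ is the function $\widetilde{S}(\theta)$ with $S e^{\iota\theta x/h}=\widetilde{S}(\theta)e^{\iota\theta x/h}$, where $\iota^2=-1$. Additive Vanka operator: given a family of finite subsets (patches) $\Upsilon_i$ of the grid whose union is the whole grid, let $V_i$ be the restriction of a grid function to $\Upsilon_i$, $V_i^T$ its transpose (extension by zero), and $A_i=V_iA_hV_i^T$. Then $M=\sum_i V_i^T W_i A_i^{-1}V_i$, where $W_i$ is the diagonal matrix whose entry at each grid point of $\Upsilon_i$ is the reciprocal of the number of patches containing that grid point. The element-wise Vanka operator $M_e$ in one dimension uses the patches $\{x_j,x_{j+1}\}$, $x_j=jh$, $j\in\mathbb{Z}$ (so $A_i=\frac{1}{h^2}\begin{pmatrix}2&-1\\-1&2\end{pmatrix}$ and $W_i=\frac12 I$). *)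

(* Defs.v *)
From HB Require Import structures.
From mathcomp Require Import all_boot all_order all_algebra finmap.
From mathcomp Require Import complex.
From mathcomp Require Import all_classical all_reals all_analysis.

Set Implicit Arguments.
Unset Strict Implicit.
Unset Printing Implicit Defensive.

Import Order.TTheory GRing.Theory Num.Theory.
Local Open Scope classical_set_scope.
Local Open Scope complex_scope.
Local Open Scope ring_scope.

(* A grid function on h Z is represented by its values at the points
   x_j = j h, that is, by a function of the integer index j. *)
Definition gridfun (R : realType) := int -> R[i].

Definition gridop (R : realType) := gridfun R -> gridfun R.

(* [\sum_(k \in setT)] is the sum over the support of the summand, which is
   finite when [s] has finitely many nonzero entries. *)
Definition stencil_op (R : realType) (s : int -> R[i]) : gridop R :=
  fun u j => \sum_(k \in [set: int]) s k * u (j + k).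

Definition laplace_stencil (R : realType) (h : R) (k : int) : R[i] :=
  ((h ^+ 2)^-1 * (if k == 0 then 2 else if `|k| == 1 then -1 else 0))%:C.

Definition laplace (R : realType) (h : R) : gridop R :=
  stencil_op (laplace_stencil h).

Section Vanka.
Variable R : realType.

(* Functions on a finite set Y of grid points are column vectors indexed by the
   positions in the enumeration of Y; the a-th point of Y is Y`_a. *)
Definition restrict (Y : {fset int}) (u : gridfun R) : 'cV[R[i]]_#|` Y| :=
  \col_a u (enum_fset Y)`_a.

Definition extend0 (Y : {fset int}) (w : 'cV[R[i]]_#|` Y|) : gridfun R :=
  fun j => \sum_(a < #|` Y| | (enum_fset Y)`_a == j) w a ord0.

(* The matrix of V A V^T, column b being the image of the b-th basis vector. *)
Definition patch_mx (A : gridop R) (Y : {fset int}) : 'M[R[i]]_#|` Y| :=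
  \matrix_(a, b) restrict Y (A (extend0 (delta_mx b ord0))) a ord0.

Variables (I : choiceType) (patch : I -> {fset int}).

Definition multiplicity (j : int) : nat :=
  #|` fset_set [set i | j \in patch i]|.

Definition weight_mx (i : I) : 'M[R[i]]_#|` patch i| :=
  diag_mx (\row_a ((multiplicity (enum_fset (patch i))`_a)%:R)^-1).

(* At a given grid point only the finitely many patches containing it
   contribute to the sum. *)
Definition vanka (A : gridop R) : gridop R :=
  fun u j => \sum_(i \in [set: I])
    extend0 (weight_mx i *m invmx (patch_mx A (patch i))
               *m restrict (patch i) u) j.

End Vanka.

Definition element_patch (j : int) : {fset int} := [fset j; (j + 1)%R]%fset.

Definition vanka_e (R : realType) (h : R) : gridop R :=
  vanka element_patch (laplace h).

Definition smoother_e (R : realType) (h omega : R) : gridop R :=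
  fun u j => u j - omega%:C * vanka_e h (laplace h u) j.

Definition expi (R : realType) (t : R) : R[i] := cos t +i* sin t.

Definition fourier_mode (R : realType) (h theta : R) : gridfun R :=
  fun j => expi (theta * (j%:~R * h) / h).

Definition is_symbol (R : realType) (h : R) (S : gridop R) (s : R -> R[i]) :=
  forall (theta : R) (j : int),
    S (fourier_mode h theta) j = s theta * fourier_mode h theta j.

Lemma is_symbol_unique (R : realType) (h : R) (S : gridop R)
    (s1 s2 : R -> R[i]) :
  is_symbol h S s1 -> is_symbol h S s2 -> s1 = s2.
Proof.
move=> H1 H2; apply/funext => theta.
have := H1 theta 0; rewrite (H2 theta 0) /fourier_mode mul0r mulr0 mul0r.
rewrite /expi cos0 sin0.
by have -> : 1 +i* 0 = 1 :> R[i] by []; rewrite !mulr1.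
Qed.

Definition cmod (R : realType) (z : R[i]) : R := ComplexField.Normc.normc z.

Definition T_high (R : realType) : set R :=
  `[- (pi / 2), 3 * pi / 2[ `\` `[- (pi / 2), pi / 2[.
Arguments T_high : clear implicits.

Definition is_max_on (R : realType) (D : set R) (f : R -> R) (m : R) :=
  (exists2 x, D x & f x = m) /\ (forall x, D x -> f x <= m).

Definition is_min_on (R : realType) (D : set R) (f : R -> R) (m : R) :=
  (exists2 x, D x & f x = m) /\ (forall x, D x -> m <= f x).

Definition is_smoothing_factor (R : realType) (h : R) (S : gridop R) (m : R) :=
  exists2 s, is_symbol h S s &
    is_max_on (T_high R) (fun theta => cmod (s theta)) m.

(* Main.v *)
(* With c = cos theta, the symbols are At = 2 (1 - c) / h^2 and
   Mt = h^2 (2 + c) / 3, so Mt At = (2/3)(1 - c)(2 + c).  As theta runs over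
   T_high, c runs over [-1, 0] and Mt At over [4/3, 3/2]; the best omega makes
   1 - (4/3) omega and 1 - (3/2) omega opposite. *)
Require Import Defs.
From HB Require Import structures.
From mathcomp Require Import all_boot all_order all_algebra finmap.
From mathcomp Require Import complex.
From mathcomp Require Import all_classical all_reals all_analysis.
From mathcomp Require Import ring lra zify.

Import Order.TTheory GRing.Theory Num.Theory.
Local Open Scope classical_set_scope.
Local Open Scope complex_scope.
Local Open Scope ring_scope.

(** * Finitely supported sums and patch matrices *)

Lemma fsum_seq (V : nmodType) (T : choiceType) (r : seq T) (F : T -> V) :
  uniq r -> (forall i, i \notin r -> F i = 0) ->
  \sum_(i \in [set: T]) F i = \sum_(i <- r) F i.
Proof.
move=> r_uniq F0; rewrite (fsbig_seq _ F r_uniq).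
by symmetry; apply: fsbig_widen => // i [_ /= /negP]; exact: F0.
Qed.

(** Passing from positions to grid points makes later computations independent of the unspecified
    order in which [enum_fset] lists a patch. *)
Lemma sum_enum_fset (V : nmodType) (Y : {fset int}) (F : int -> V) :
  \sum_(a < #|` Y|) F (enum_fset Y)`_a = \sum_(y <- enum_fset Y) F y.
Proof.
by rewrite (big_nth 0 xpredT F) (big_mkord xpredT (fun a => F (enum_fset Y)`_a)).
Qed.

Lemma mem_nth_fset (Y : {fset int}) (a : 'I_#|` Y|) : (enum_fset Y)`_a \in Y.
Proof. exact: mem_nth. Qed.

Lemma eq_nth_fset (Y : {fset int}) (a b : 'I_#|` Y|) :
  ((enum_fset Y)`_a == (enum_fset Y)`_b) = (a == b).
Proof. by rewrite nth_uniq ?fset_uniq. Qed.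

Lemma extend0_col (R : realType) (Y : {fset int}) (G : int -> R[i]) (j : int) :
  extend0 (\col_(a < #|` Y|) G (enum_fset Y)`_a) j =
  \sum_(y <- enum_fset Y) (if y == j then G y else 0).
Proof.
rewrite /extend0 -sum_enum_fset big_mkcond; apply: eq_bigr => a _.
by rewrite mxE.
Qed.

Lemma extend0_delta (R : realType) (Y : {fset int}) (b : 'I_#|` Y|) (j : int) :
  extend0 (delta_mx b ord0) j = ((enum_fset Y)`_b == j)%:R :> R[i].
Proof.
rewrite /extend0 big_mkcond (bigD1 b) //= big1 ?addr0.
  by rewrite mxE !eqxx; case: ifP.
by move=> a ab; rewrite mxE (negbTE ab) if_same.
Qed.

(** Column [b] is the stencil applied to the indicator of the [b]-th point; at the [a]-th point only
    the offset leading from the latter to the former hits it. *)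
Lemma patch_mx_stencil (R : realType) (s : int -> R[i]) (Y : {fset int}) :
  patch_mx (stencil_op s) Y =
  \matrix_(a, b) s ((enum_fset Y)`_b - (enum_fset Y)`_a).
Proof.
apply/matrixP => a b; rewrite !mxE /stencil_op.
rewrite (@fsum_seq _ _ [:: (enum_fset Y)`_b - (enum_fset Y)`_a]) //.
  by rewrite big_seq1 extend0_delta [_ + (_ - _)]addrC subrK eqxx mulr1.
move=> k; rewrite inE extend0_delta => /eqP k_neq.
case: eqP => [yb|]; last by rewrite mulr0.
by case: k_neq; rewrite yb addrC addKr.
Qed.

(** * The element patches and the stencil of the Vanka operator *)

Lemma big_element_patch (V : nmodType) (x : int) (F : int -> V) :
  \sum_(y <- enum_fset (element_patch x)) F y = F x + F (x + 1).
Proof.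
have /(perm_big _) -> : perm_eq (enum_fset (element_patch x)) [:: x; x + 1].
  apply: uniq_perm => //=; first by rewrite inE andbT; lia.
  by move=> y; rewrite -[LHS]/(y \in element_patch x) !inE.
by rewrite big_cons big_seq1.
Qed.

Lemma multiplicity_element_patch (x : int) : multiplicity element_patch x = 2%N.
Proof.
rewrite /multiplicity.
have -> : [set i | x \in element_patch i] = [set` [fset x; x - 1]%fset].
  by apply/seteqP; split=> i /=; rewrite !inE; lia.
rewrite set_fsetK cardfs2.
by have -> : x != x - 1 by lia.
Qed.

Lemma laplace_stencilN (R : realType) (h : R) (k : int) :
  laplace_stencil h (- k) = laplace_stencil h k.
Proof. by rewrite /laplace_stencil oppr_eq0 normrN. Qed.

Lemma laplace_stencil0 (R : realType) (h : R) :
  laplace_stencil h 0 = 2 / (h ^+ 2)%:C.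
Proof. by rewrite /laplace_stencil eqxx rmorphM fmorphV rmorph_nat mulrC. Qed.

Lemma laplace_stencil1 (R : realType) (h : R) :
  laplace_stencil h 1 = - 1 / (h ^+ 2)%:C.
Proof. by rewrite /laplace_stencil /= rmorphM fmorphV rmorphN rmorph1 mulrC. Qed.

Lemma laplaceE (R : realType) (h : R) (u : gridfun R) (j : int) :
  laplace h u j = (2 * u j - u (j - 1) - u (j + 1)) / (h ^+ 2)%:C.
Proof.
rewrite /laplace /stencil_op (@fsum_seq _ _ [:: 0; -1; 1]) //.
  rewrite !big_cons big_nil laplace_stencilN laplace_stencil0 laplace_stencil1.
  by rewrite addr0; ring.
move=> k; rewrite !inE /laplace_stencil => /norP[/negbTE -> k_neq].
have -> : (`|k| == 1) = false by lia.
by rewrite mulr0 mul0r.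
Qed.

(** The inverse of the 2 by 2 matrix with rows (2, -1) and (-1, 2) is one third of that with rows
    (2, 1) and (1, 2), whose entries are 1 plus a Kronecker delta. Comparing points instead of
    indices avoids fixing their order. *)
Lemma invmx_laplace_element_patch (R : realType) (h : R) (x : int) :
  0 < h ->
  invmx (patch_mx (laplace h) (element_patch x)) =
  \matrix_(a, b) ((h ^+ 2)%:C / 3 *
    (1 + ((enum_fset (element_patch x))`_a ==
          (enum_fset (element_patch x))`_b)%:R)).
Proof.
move=> h_gt0; set B := (X in _ = X).
(* For square matrices a right inverse is the inverse, so one product suffices. *)
suff AB1 : patch_mx (laplace h) (element_patch x) *m B = 1%:M.
  have [A_unit _] := mulmx1_unit AB1.
  by rewrite -[RHS](mulKmx A_unit) AB1 mulmx1.
have h2_neq0 : (h ^+ 2)%:C != 0 :> R[i].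
  by rewrite fmorph_eq0 expf_eq0 /= gt_eqF.
apply/matrixP => a c; rewrite patch_mx_stencil !mxE -eq_nth_fset.
under eq_bigr do rewrite !mxE.
rewrite (sum_enum_fset _ _ (fun y => laplace_stencil h (y - _) *
  (_ * (1 + (y == (enum_fset (element_patch x))`_c)%:R)))) big_element_patch.
have x1E : (x + 1 == x) = false by lia.
have xE1 : (x == x + 1) = false by lia.
have xBx1 : x - (x + 1) = - 1 by ring.
have x1Bx : x + 1 - x = 1 by ring.
(* Row and column points are each [x] or [x + 1]: four scalar identities remain. *)
have := mem_nth_fset _ a; have := mem_nth_fset _ c.
rewrite !inE => /orP[] /eqP -> /orP[] /eqP ->;
  rewrite ?subrr ?xBx1 ?x1Bx ?laplace_stencilN ?laplace_stencil0;
  rewrite laplace_stencil1 ?eqxx ?x1E ?xE1 /=;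
  by move: (_%:C) h2_neq0 => z z_neq0; field.
Qed.

(** The two patches containing [j] each contribute, with weight 1/2, a local correction [h ^+ 2 / 3]
    times twice the value at [j] plus the value at the other point. Their sum is the mass-type
    stencil [h ^+ 2 / 6] times [1 4 1]. *)
Lemma vanka_eE (R : realType) (h : R) (u : gridfun R) (j : int) :
  0 < h ->
  vanka_e h u j = (h ^+ 2)%:C / 6 * (4 * u j + u (j - 1) + u (j + 1)).
Proof.
move=> h_gt0; rewrite /vanka_e /vanka.
(* The contribution of patch [i], split according to whether [j] is its left or its right point. *)
have term i : extend0 (weight_mx R element_patch i
      *m invmx (patch_mx (laplace h) (element_patch i))
      *m Defs.restrict (element_patch i) u) j =
    (if i == j then (h ^+ 2)%:C / 6 * (2 * u i + u (i + 1)) else 0) +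
    (if i + 1 == j then (h ^+ 2)%:C / 6 * (u i + 2 * u (i + 1)) else 0).
  rewrite invmx_laplace_element_patch // /weight_mx.
  (* The weighted local correction as a function of the grid point, the form required by
     [extend0_col]; [2^-1] is the reciprocal multiplicity. *)
  pose G y := 2^-1 * (\sum_(z <- enum_fset (element_patch i))
    (h ^+ 2)%:C / 3 * (1 + (y == z)%:R) * u z).
  rewrite -mulmxA mul_diag_mx.
  rewrite (_ : \matrix_(_, _) _ =
    \col_(a < #|` element_patch i|) G (enum_fset (element_patch i))`_a); last first.
    apply/matrixP => a b; rewrite !mxE multiplicity_element_patch /G.
    rewrite -sum_enum_fset; congr (_ * _); apply: eq_bigr => c _.
    by rewrite !mxE.
  rewrite extend0_col big_element_patch /G !big_element_patch !eqxx.
  have -> : (i + 1 == i) = false by lia.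
  have -> : (i == i + 1) = false by lia.
  by congr (_ + _); case: ifP => // _ /=; field.
under eq_fsbigr do rewrite term.
rewrite (@fsum_seq _ _ [:: j; j - 1]); last first.
- move=> i; rewrite !inE => /norP[/negbTE -> ij].
  have -> : (i + 1 == j) = false by lia.
  by rewrite addr0.
- by rewrite /= inE andbT; lia.
rewrite big_cons big_seq1 subrK !eqxx.
have -> : (j + 1 == j) = false by lia.
have -> : (j - 1 == j) = false by lia.
by ring.
Qed.

(** * Fourier modes and symbols *)

Lemma fourier_modeD (R : realType) (h theta : R) (j k : int) : h != 0 ->
  fourier_mode h theta (j + k) =
  expi (theta * k%:~R) * fourier_mode h theta j.
Proof.
move=> h_neq0; rewrite /fourier_mode !mulrA !mulfK // rmorphD mulrDr /expi.
rewrite cosD sinD; apply/eqP; rewrite eq_complex /=.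
by apply/andP; split; apply/eqP; ring.
Qed.

Lemma expiDN (R : realType) (t : R) : expi t + expi (- t) = (2 * cos t)%:C.
Proof.
rewrite /expi cosN sinN; apply/eqP; rewrite eq_complex /=.
by apply/andP; split; apply/eqP; ring.
Qed.

Lemma fourier_mode_neighbours (R : realType) (h theta : R) (j : int) : h != 0 ->
  fourier_mode h theta (j - 1) + fourier_mode h theta (j + 1) =
  (2 * cos theta)%:C * fourier_mode h theta j.
Proof.
move=> h_neq0; rewrite !fourier_modeD // -expiDN rmorphN rmorph1 mulr1 mulrN1.
by rewrite addrC mulrDl.
Qed.

Definition laplace_symbol {R : realType} (h theta : R) : R[i] :=
  (2 * (1 - cos theta) / h ^+ 2)%:C.

Definition vanka_e_symbol {R : realType} (h theta : R) : R[i] :=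
  (h ^+ 2 * (2 + cos theta) / 3)%:C.

Lemma laplace_is_symbol (R : realType) (h : R) : 0 < h ->
  is_symbol h (laplace h) (laplace_symbol h).
Proof.
move=> /lt0r_neq0 h_neq0 theta j.
rewrite laplaceE -addrA -opprD fourier_mode_neighbours // /laplace_symbol.
by rewrite !rmorphE /=; field; rewrite fmorph_eq0.
Qed.

Lemma vanka_e_is_symbol (R : realType) (h : R) : 0 < h ->
  is_symbol h (vanka_e h) (vanka_e_symbol h).
Proof.
move=> h_gt0 theta j; have h_neq0 := lt0r_neq0 h_gt0.
rewrite vanka_eE // -addrA fourier_mode_neighbours // /vanka_e_symbol.
by rewrite !rmorphE /=; field.
Qed.

Lemma smoother_e_is_symbol (R : realType) (h omega : R) : 0 < h ->
  is_symbol h (smoother_e h omega)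
    (fun theta => 1 - omega%:C * vanka_e_symbol h theta * laplace_symbol h theta).
Proof.
move=> h_gt0 theta j; have MF := vanka_e_is_symbol _ _ h_gt0 theta j.
rewrite /smoother_e; set s := laplace_symbol h theta.
have -> : vanka_e h (laplace h (fourier_mode h theta)) j =
          s * vanka_e h (fourier_mode h theta) j.
  (* The explicit stencil is linear, so the eigenvalue [s] of the Laplacian factors out of its three
     terms. *)
  by rewrite !vanka_eE // !(laplace_is_symbol _ _ h_gt0) -/s; ring.
by rewrite MF; ring.
Qed.

Lemma cmod_real (R : realType) (x : R) : cmod x%:C = `|x|.
Proof. by rewrite /cmod /= expr0n addr0 sqrtr_sqr. Qed.

(** Both symbols are real and their powers of [h] cancel, so the smoothing factor is independent of
    [h]. *)
Lemma cmod_smoother_symbol (R : realType) (h omega theta : R) : 0 < h ->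
  cmod (1 - omega%:C * vanka_e_symbol h theta * laplace_symbol h theta) =
  `|1 - omega * (2 / 3 * (1 - cos theta) * (2 + cos theta))|.
Proof.
move=> /lt0r_neq0 h_neq0; rewrite -cmod_real; congr cmod.
rewrite /vanka_e_symbol /laplace_symbol -!rmorphM -(rmorph1 (real_complex R)).
by rewrite -rmorphB; congr _%:C; field.
Qed.

(** * Maximum over the high frequencies *)

Lemma T_highE (R : realType) (theta : R) :
  T_high R theta <-> pi / 2 <= theta < 3 * pi / 2.
Proof.
have pi_gt0 := pi_gt0 R; rewrite /T_high /= !in_itv /=; split.
  by case=> /andP[-> ->] /negP; rewrite negb_and -leNgt => /orP[/negP//|->].
move=> /andP[le_theta lt_theta]; split; first by rewrite lt_theta andbT; lra.
by apply/negP; rewrite negb_and -!leNgt le_theta orbT.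
Qed.

Lemma cos_T_high (R : realType) (theta : R) :
  T_high R theta -> -1 <= cos theta <= 0.
Proof.
move=> /T_highE /andP[le_theta lt_theta]; rewrite cos_geN1 /=.
(* Shifting by [pi] moves the angle into [[-pi/2, pi/2)] and changes the sign of the cosine. *)
have := @cos_ge0_pihalf R (theta - pi); rewrite cosB cospi sinpi.
by move=> /(_ _)/wrap[]; [apply/andP; split; lra | lra].
Qed.

(** The modulus of an affine function of [lam] is convex, so on [[4/3, 3/2]] it is largest at an
    endpoint. *)
Lemma smoothing_bound (R : realType) (omega c : R) : -1 <= c <= 0 ->
  `|1 - omega * (2 / 3 * (1 - c) * (2 + c))| <=
  Num.max `|1 - omega * (4 / 3)| `|1 - omega * (3 / 2)|.
Proof.
move=> /andP[c_ge c_le]; set lam := 2 / 3 * (1 - c) * (2 + c).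
(* Here [lam - 4/3 = - (2/3) c (1 + c)] and [3/2 - lam = (2 c + 1)^2 / 6]. *)
have lam_ge : 4 / 3 <= lam by rewrite /lam; nra.
have lam_le : lam <= 3 / 2 by have := sqr_ge0 (2 * c + 1); rewrite /lam; nra.
set m := Num.max _ _.
have : `|1 - omega * (4 / 3)| <= m by rewrite le_max lexx.
have : `|1 - omega * (3 / 2)| <= m by rewrite le_max lexx orbT.
rewrite !ler_norml => /andP[? ?] /andP[? ?].
have [w_ge0|w_lt0] := leP 0 omega.
  have ? : omega * (4 / 3) <= omega * lam by rewrite ler_wpM2l.
  have ? : omega * lam <= omega * (3 / 2) by rewrite ler_wpM2l.
  by lra.
have ? : omega * lam <= omega * (4 / 3) by rewrite ler_wnM2l // ltW.
have ? : omega * (3 / 2) <= omega * lam by rewrite ler_wnM2l // ltW.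
by lra.
Qed.

Lemma smoothing_factor_e (R : realType) (h omega : R) : 0 < h ->
  is_max_on (T_high R)
    (fun theta => cmod
      (1 - omega%:C * vanka_e_symbol h theta * laplace_symbol h theta))
    (Num.max `|1 - omega * (4 / 3)| `|1 - omega * (3 / 2)|).
Proof.
move=> h_gt0; have pi_gt0 := pi_gt0 R; split; last first.
  move=> theta /cos_T_high cos_theta; rewrite cmod_smoother_symbol //.
  exact: smoothing_bound.
(* The larger endpoint value decides where the maximum is attained. *)
have [_|_] := leP `|1 - omega * (4 / 3)| `|1 - omega * (3 / 2)|.
  have half_itv : (- (2^-1) : R) \in `[-1, 1] by rewrite in_itv /=; lra.
  (* The value 3/2 occurs at cosine -1/2. This angle is at least [pi / 2], since a smaller one would
     have positive cosine. *)
  exists (acos (- (2^-1))).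
    apply/T_highE; rewrite (@le_lt_trans _ _ pi) ?acos_lepi ?andbT; [|lra..].
    rewrite leNgt; apply/negP => lt_acos.
    have : 0 < cos (acos (- (2^-1) : R)).
      apply: cos_gt0_pihalf; rewrite lt_acos andbT.
      by rewrite (lt_le_trans _ (acos_ge0 _)) // oppr_lt0 divr_gt0.
    by rewrite acosK //=; lra.
  by rewrite cmod_smoother_symbol // acosK //=; congr `|1 - omega * _|; field.
(* The value 4/3 occurs at cosine 0, and the closed left end [pi / 2] lies in [T_high]. *)
exists (pi / 2); first by apply/T_highE; lra.
by rewrite cmod_smoother_symbol // cos_pihalf; congr `|1 - omega * _|; field.
Qed.

(** * Minimization over [omega] *)

Lemma smoothing_factor_ge (R : realType) (omega : R) :
  1 / 17 <= Num.max `|1 - omega * (4 / 3)| `|1 - omega * (3 / 2)|.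
(* The combination [9 (1 - 4/3 omega) - 8 (1 - 3/2 omega) = 1] eliminates [omega]; as 9 + 8 = 17,
   both moduli cannot be below 1/17. *)
Proof. by rewrite le_max !ler_normr; lra. Qed.

Lemma smoothing_factor_eq (R : realType) (omega : R) :
  Num.max `|1 - omega * (4 / 3)| `|1 - omega * (3 / 2)| = 1 / 17 <->
  omega = 12 / 17.
Proof.
split=> [max_eq|->].
  have : Num.max `|1 - omega * (4 / 3)| `|1 - omega * (3 / 2)| <= 1 / 17.
    by rewrite max_eq.
  (* [1 - 4/3 omega <= 1/17] gives [omega >= 12/17], and [3/2 omega - 1 <= 1/17] gives
     [omega <= 12/17]. *)
  by rewrite ge_max !ler_norml; lra.
by apply/le_anti; rewrite smoothing_factor_ge andbT ge_max !ler_norml; lra.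
Qed.

Theorem theorem3p1 (R : realType) (h : R) (h_gt0 : 0 < h) :
  exists (At Mt : R -> R[i]) (mu : R -> R),
    [/\ is_symbol h (laplace h) At, is_symbol h (vanka_e h) Mt &
        forall omega : R, is_smoothing_factor h (smoother_e h omega) (mu omega)]
    /\
    [/\ forall omega : R,
          is_max_on (T_high R)
            (fun theta => cmod (1 - omega%:C * Mt theta * At theta)) (mu omega),
        is_min_on [set: R] mu (1 / 17) &
        forall omega : R, mu omega = 1 / 17 <-> omega = 12 / 17].
Proof.
exists (laplace_symbol h), (vanka_e_symbol h).
exists (fun omega => Num.max `|1 - omega * (4 / 3)| `|1 - omega * (3 / 2)|).
split; split.
- exact: laplace_is_symbol.
- exact: vanka_e_is_symbol.
- move=> omega; exists (fun theta =>
    1 - omega%:C * vanka_e_symbol h theta * laplace_symbol h theta).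
    exact: smoother_e_is_symbol.
  exact: smoothing_factor_e.
- by move=> omega; exact: smoothing_factor_e.
- split=> [|omega _]; last exact: smoothing_factor_ge.
  by exists (12 / 17) => //; apply/smoothing_factor_eq.
- exact: smoothing_factor_eq.
Qed.
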